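(* Let $\mathscr{F}$ be an arbitrary $\omega$-closed family of nonempty inductive subsets of $\omega$ and let $\mathfrak{C}$ be a congruence on the semigroup $\boldsymbol{B}_{\omega}^{\mathscr{F}}$. Then the following conditions are equivalent: (1) $\mathfrak{C}$ is a group congruence on $\boldsymbol{B}_{\omega}^{\mathscr{F}}$; (2) there exists a subsemigroup $S$ of $\boldsymbol{B}_{\omega}^{\mathscr{F}}$ which is isomorphic to the bicyclic semigroup and such that some two distinct elements of $S$ are $\mathfrak{C}$-equivalent; (3) for every subsemigroup $T$ of $\boldsymbol{B}_{\omega}^{\mathscr{F}}$ which is isomorphic to the bicyclic semigroup, some two distinct elements of $T$ are $\mathfrak{C}$-equivalent.
   Context: $\omega$ is the set of nonnegative integers. A subset $A\subseteq\omega$ is inductive if $i\in A$ implies $i+1\in A$. For an integer $n$ and $F\subseteq\omega$ put $n+F=\{n+k\colon k\in F\}$ (a subset of $\mathbb{Z}$). A nonempty family $\mathscr{F}\subseteq\mathscr{P}(\omega)$ is $\omega$-closed if $F_1\cap(-n+F_2)\in\mathscr{F}$ for all $n\in\omega$ and $F_1,F_2\in\mathscr{F}$. For an $\omega$-closed family $\mathscr{F}$ with $\varnothing\notin\mathscr{F}$, $\boldsymbol{B}_{\omega}^{\mathscr{F}}$ is the set of triples $(i,j,F)$ with $i,j\in\omega$, $F\in\mathscr{F}$, with the (associative) operation $$(i_1,j_1,F_1)\cdot(i_2,j_2,F_2)=\begin{cases}(i_1-j_1+i_2,\,j_2,\,(j_1-i_2+F_1)\cap F_2), & j_1<i_2;\\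 (i_1,\,j_2,\,F_1\cap F_2), & j_1=i_2;\\ (i_1,\,j_1-i_2+j_2,\,F_1\cap(i_2-j_1+F_2)), & j_1>i_2.\end{cases}$$ The bicyclic semigroup is (up to isomorphism) $\boldsymbol{B}_\omega=\omega\times\omega$ with $(i_1,j_1)\cdot(i_2,j_2)=(i_1+i_2-\min\{j_1,i_2\},\,j_1+j_2-\min\{j_1,i_2\})$. A congruence on a semigroup $S$ is an equivalence relation compatible with left and right multiplication. A congruence $\mathfrak{K}$ on $S$ is a group congruence if the quotient semigroup $S/\mathfrak{K}$ is isomorphic to a group. Elements $a,b$ are $\mathfrak{C}$-equivalent if $(a,b)\in\mathfrak{C}$. *)

(* Defs.v *)
From HB Require Import structures.
From mathcomp Require Import all_boot ssralg ssrint.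
From mathcomp Require Import boolp classical_sets zify.

Set Implicit Arguments.
Unset Strict Implicit.
Unset Printing Implicit Defensive.

Import GRing.Theory.

Local Open Scope classical_set_scope.
Local Open Scope int_scope.
Local Open Scope nat_scope.

Section Semigroups.
Local Open Scope group_scope.

Definition isomorphic (S T : semigroupType) : Prop :=
  exists f : {multiplicative S -> T}, bijective f.

(* The empty carrier is allowed; it is never isomorphic to the bicyclic
   semigroup. *)
Record subsemigroup (S : semigroupType) := Subsemigroup {
  subsemigroup_set : set S;
  subsemigroupM : forall x y : S,
    subsemigroup_set x -> subsemigroup_set y -> subsemigroup_set (x * y)
}.

Definition subsemigroup_type (S : semigroupType) (A : subsemigroup S) : Type :=
  set_type (subsemigroup_set A).

Section SubsemigroupType.
Context (S : semigroupType) (A : subsemigroup S).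

Lemma subsemigroup_mulg_closed :
  mulg_closed (fun x => x \in subsemigroup_set A).
Proof.
by move=> x y /set_mem Ax /set_mem Ay; apply/mem_set; apply: subsemigroupM.
Qed.

HB.instance Definition _ := SubChoice.on (subsemigroup_type A).
HB.instance Definition _ := SubChoice_isSubSemigroup.Build S
  (fun x => x \in subsemigroup_set A) (subsemigroup_type A)
  subsemigroup_mulg_closed.

End SubsemigroupType.

Record congruence (S : semigroupType) := Congruence {
  congruence_rel :> S -> S -> Prop;
  congruence_refl : forall x, congruence_rel x x;
  congruence_sym : forall x y, congruence_rel x y -> congruence_rel y x;
  congruence_trans : forall x y z,
    congruence_rel x y -> congruence_rel y z -> congruence_rel x z;
  congruenceMl : forall z x y,
    congruence_rel x y -> congruence_rel (z * x) (z * y);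
  congruenceMr : forall z x y,
    congruence_rel x y -> congruence_rel (x * z) (y * z)
}.

Section Quotient.
Local Open Scope quotient_scope.
Context (S : semigroupType) (C : congruence S).

Definition congruence_bool : rel S := fun x y => `[< C x y >].

Lemma congruence_equiv_class : equiv_class_of congruence_bool.
Proof.
split=> [x|x y|y x z].
- by apply/asboolP; apply: congruence_refl.
- by apply/asboolP/asboolP; apply: congruence_sym.
- by move=> /asboolP xy /asboolP yz; apply/asboolP; apply: congruence_trans yz.
Qed.

Canonical congruence_equiv := EquivRelPack congruence_equiv_class.

Definition quotient_semigroup : Type := {eq_quot congruence_equiv}.

HB.instance Definition _ := Choice.on quotient_semigroup.
HB.instance Definition _ := EqQuotient.on quotient_semigroup.

Definition quotient_mul : quotient_semigroup -> quotient_semigroup ->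
  quotient_semigroup := lift_op2 quotient_semigroup (@mul S).

Lemma pi_eqP (x y : S) :
  reflect (C x y) (\pi_quotient_semigroup x == \pi_quotient_semigroup y).
Proof. by rewrite eqmodE; apply: asboolP. Qed.

Lemma pi_quotient_mul :
  {morph \pi_quotient_semigroup : x y / x * y >-> quotient_mul x y}.
Proof.
move=> x y; unlock quotient_mul; apply/eqP/pi_eqP.
have Cr z : C z (repr (\pi_quotient_semigroup z)).
  by apply/pi_eqP; rewrite reprK.
exact: congruence_trans (congruenceMr _ (Cr x)) (congruenceMl _ (Cr y)).
Qed.

Lemma quotient_mulA : associative quotient_mul.
Proof.
elim/quotW=> x; elim/quotW=> y; elim/quotW=> z.
by rewrite -!pi_quotient_mul mulgA.
Qed.

HB.instance Definition _ := isSemigroup.Build quotient_semigroup quotient_mulA.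

End Quotient.

Definition group_congruence (S : semigroupType) (C : congruence S) : Prop :=
  exists G : groupType, isomorphic (quotient_semigroup C) G.

End Semigroups.

Definition bicyclic : Type := (nat * nat)%type.

HB.instance Definition _ := Choice.on bicyclic.

Definition bicyclic_mul (x y : bicyclic) : bicyclic :=
  let: (i1, j1) := x in let: (i2, j2) := y in
  (i1 + i2 - minn j1 i2, j1 + j2 - minn j1 i2).

Lemma bicyclic_mulA : associative bicyclic_mul.
Proof. by case=> [i1 j1] [i2 j2] [i3 j3] /=; congr pair; lia. Qed.

HB.instance Definition _ := isSemigroup.Build bicyclic bicyclic_mulA.

Definition inductive_set (A : set nat) : Prop := forall i, A i -> A i.+1.

Definition zshift (n : int) (A : set nat) : set int :=
  [set (n + k%:Z)%R | k in A].

(* [A] intersected, within omega, with a set of integers. *)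
Definition natI (A : set nat) (Z : set int) : set nat :=
  A `&` [set k : nat | Z k%:Z].

Record omega_closed_family := OmegaClosedFamily {
  family_set : set (set nat);
  family_nonempty : family_set !=set0;
  family_closed : forall (n : nat) (F1 F2 : set nat),
    family_set F1 -> family_set F2 ->
    family_set (natI F1 (zshift (- n%:Z)%R F2))
}.

(* In the first and third cases the natural number subtractions
   [i1 + i2 - j1] and [j1 + j2 - i2] are not truncated. *)
Definition triple_mul (x y : nat * nat * set nat) : nat * nat * set nat :=
  let: (i1, j1, F1) := x in let: (i2, j2, F2) := y in
  if j1 < i2 then
    (i1 + i2 - j1, j2, natI F2 (zshift (j1%:Z - i2%:Z)%R F1))
  else if j1 == i2 then
    (i1, j2, F1 `&` F2)
  else
    (i1, j1 + j2 - i2, natI F1 (zshift (i2%:Z - j1%:Z)%R F2)).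

Lemma zshiftE (a b : nat) (A : set nat) (k : nat) : (a <= b)%N ->
  zshift (a%:Z - b%:Z)%R A k%:Z <-> A (k + (b - a))%N.
Proof.
move=> ab; split=> [[m Am mk]|Ak].
  by have -> : (k + (b - a))%N = m by lia.
by exists (k + (b - a))%N => //; lia.
Qed.

Lemma eq_set_elt (A : set nat) (k l : nat) : A k -> k = l -> A l.
Proof. by move=> Ak <-. Qed.

Lemma triple_mulE (i1 j1 i2 j2 : nat) (F1 F2 : set nat) :
  triple_mul (i1, j1, F1) (i2, j2, F2) =
  (i1 + i2 - minn j1 i2, j1 + j2 - minn j1 i2,
   [set k | F1 (k + (i2 - j1)) /\ F2 (k + (j1 - i2))]).
Proof.
rewrite /triple_mul; case: ltngtP => ij; congr (_, _, _); try lia;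
  apply/seteqP; split=> k /= [h1 h2].
- move/(zshiftE _ _ (ltnW ij)): h2 => h2.
  by split; [apply: (eq_set_elt h2); lia|apply: (eq_set_elt h1); lia].
- split; first by apply: (eq_set_elt h2); lia.
  by apply/(zshiftE _ _ (ltnW ij)); apply: (eq_set_elt h1); lia.
- move/(zshiftE _ _ (ltnW ij)): h2 => h2.
  by split; [apply: (eq_set_elt h1); lia|apply: (eq_set_elt h2); lia].
- split; first by apply: (eq_set_elt h1); lia.
  by apply/(zshiftE _ _ (ltnW ij)); apply: (eq_set_elt h2); lia.
- by split; [apply: (eq_set_elt h1); lia|apply: (eq_set_elt h2); lia].
- by split; [apply: (eq_set_elt h1); lia|apply: (eq_set_elt h2); lia].
Qed.

Lemma triple_mulA : associative triple_mul.
Proof.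
case=> [[i1 j1] F1] [[i2 j2] F2] [[i3 j3] F3].
rewrite !triple_mulE; congr (_, _, _); try lia.
apply/seteqP; split=> k /=.
- move=> [h1 [h2 h3]]; split; first split.
  + by apply: (eq_set_elt h1); lia.
  + by apply: (eq_set_elt h2); lia.
  + by apply: (eq_set_elt h3); lia.
- move=> [[h1 h2] h3]; split; last split.
  + by apply: (eq_set_elt h1); lia.
  + by apply: (eq_set_elt h2); lia.
  + by apply: (eq_set_elt h3); lia.
Qed.

Definition triples (F : omega_closed_family) : set (nat * nat * set nat) :=
  [set x | family_set F x.2].

Lemma triple_mul_closed (F : omega_closed_family) x y :
  triples F x -> triples F y -> triples F (triple_mul x y).
Proof.
case: x y => [[i1 j1] F1] [[i2 j2] F2]; rewrite /triples /= => FF1 FF2.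
case: ltngtP => ij /=.
- have -> : (j1%:Z - i2%:Z)%R = (- (i2 - j1)%N%:Z)%R by lia.
  exact: family_closed.
- have -> : (i2%:Z - j1%:Z)%R = (- (j1 - i2)%N%:Z)%R by lia.
  exact: family_closed.
- suff -> : F1 `&` F2 = natI F1 (zshift (- 0%N%:Z)%R F2).
    exact: family_closed.
  have -> : (- 0%N%:Z)%R = (0%N%:Z - 0%N%:Z)%R by lia.
  apply/seteqP; split=> k [F1k F2k]; split=> //=.
    by apply/(zshiftE _ _ (leqnn 0)); rewrite addn0.
  by move/(zshiftE _ _ (leqnn 0)): F2k; rewrite addn0.
Qed.

Definition BwF (F : omega_closed_family) : Type := set_type (triples F).

Section BwF.
Context (F : omega_closed_family).

HB.instance Definition _ := SubChoice.on (BwF F).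

Definition BwF_mul (x y : BwF F) : BwF F :=
  SigSub (mem_set (triple_mul_closed (set_valP x) (set_valP y))).

Lemma BwF_mulA : associative BwF_mul.
Proof. by move=> x y z; apply: val_inj => /=; rewrite triple_mulA. Qed.

HB.instance Definition _ := isSemigroup.Build (BwF F) BwF_mulA.

End BwF.

(* Main.v *)
From HB Require Import structures.
Require Import Defs.
From mathcomp Require Import all_boot.
From mathcomp Require Import boolp classical_sets.
From mathcomp Require Import zify.

(** A nonempty inductive set is a half-line [a, oo), so an element of the
semigroup is a pair (i, j) together with the starting point a of its set.
Besides (i, j), the shifted pair (i + a, j + a) also multiplies as in the
bicyclic semigroup: it records the ends of the domain and of the range of a shift
between half-lines, and shifts compose by taking a maximum of ends, exactly as
bicyclic multiplication does.  Hence x |-> (pos x, apex x) embeds the whole semigroup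
into the square of the bicyclic one ([posM], [apexM], [pos_apex_inj]), and
every identity below is checked in the two coordinates by linear arithmetic.

Fixing the set of x and letting (i, j) vary gives a copy of the bicyclic
semigroup ([layer]).  The coordinates also show that the identity h (0, 0) of
any copy h of the bicyclic semigroup and its idempotent h (1, 1) are two
distinct idempotents of one single layer ([copy_translate]).

Suppose that a congruence identifies two distinct elements of some copy.
A congruence on the bicyclic semigroup that is not the equality identifies
all idempotents ([bicyclic_congruence]); applied first to the copy and then to
the layer, this collapses all idempotents of that layer.  The idempotents are
ordered by their positions and starting points, each of them is interleaved,
possibly after conjugation, with those of the layer, and so all idempotents
become congruent ([idempotents_congruent]).  The semigroup being regular, the
quotient is then a group ([idempotent_group_congruence]).

Conversely a group has a single idempotent, whereas a copy of the bicyclic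
semigroup has several, so a group congruence identifies two elements of every
copy; and copies exist, since every layer is one. *)

Set Implicit Arguments.
Unset Strict Implicit.
Unset Printing Implicit Defensive.

Local Open Scope group_scope.
Local Open Scope quotient_scope.
Local Open Scope classical_set_scope.
Local Open Scope nat_scope.

(** * Congruences on semigroups *)

Lemma group_congruence_idempotent (S : semigroupType) (C : congruence S) :
  group_congruence C ->
  forall e f : S, (e * e = e)%g -> (f * f = f)%g -> C e f.
Proof.
move=> [G [phi phi_bij]] e f ee ff; apply/pi_eqP/eqP.
apply: (bij_inj phi_bij).
suff one x : (x * x = x)%g ->
    phi (\pi_(quotient_semigroup C) x) = 1%g by rewrite !one.
move=> xx; apply: (mulgI (phi (\pi_(quotient_semigroup C) x))).
rewrite mulg1 -gmulfM; congr (phi _).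
by rewrite -[RHS](congr1 _ xx) pi_quotient_mul.
Qed.

(** In a regular semigroup both x x' and x' x are idempotent, where x' is the
chosen [inv x]; once all idempotents are congruent they give the identity of the
quotient, and x' gives the inverse of x. *)
Lemma idempotent_group_congruence (S : semigroupType) (C : congruence S)
    (inv : S -> S) (e : S) :
  (forall x, x * inv x * x = x)%g ->
  (forall f g : S, f * f = f -> g * g = g -> C f g)%g ->
  group_congruence C.
Proof.
move=> xVx idC.
set Q := quotient_semigroup C.
have xV x : (x * inv x * (x * inv x) = x * inv x)%g by rewrite mulgA xVx.
have Vx x : (inv x * x * (inv x * x) = inv x * x)%g.
  by rewrite -mulgA (mulgA x) xVx.
pose one : Q := \pi_Q (e * inv e)%g.
pose invq (q : Q) : Q := \pi_Q (inv (repr q)).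
have xVE x : \pi_Q (x * inv x)%g = one by apply/eqP/pi_eqP/idC.
have VxE x : \pi_Q (inv x * x)%g = one by apply/eqP/pi_eqP/idC.
have piM x y : \pi_Q (x * y)%g = (\pi_Q x * \pi_Q y)%g := pi_quotient_mul C x y.
have mul1 : left_id one (@mul Q).
  by elim/quotW=> x; rewrite -(xVE x) -piM xVx.
have mulr1 : right_id one (@mul Q).
  by elim/quotW=> x; rewrite -(VxE x) -piM mulgA xVx.
have mulV : left_inverse one invq (@mul Q).
  by move=> q; rewrite -{2}[q]reprK -piM VxE.
have mulrV : right_inverse one invq (@mul Q).
  by move=> q; rewrite -{1}[q]reprK -piM xVE.
pose G : groupType :=
  HB.pack Q (isGroup.Build Q (@mulgA Q) mul1 mulr1 mulV mulrV).
exists G.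
pose idQ : {multiplicative Q -> G} :=
  HB.pack (fun q : Q => q : G)
    (isMultiplicative.Build Q G (fun q => q) (fun _ _ => erefl)).
by exists idQ; exists id.
Qed.

Section CongruencePreim.
Context (S T : semigroupType) (h : S -> T) (hM : {morph h : x y / (x * y)%g}).
Context (C : congruence T).

Lemma congruence_preimMl (z x y : S) :
  C (h x) (h y) -> C (h (z * x)%g) (h (z * y)%g).
Proof. by rewrite !hM; apply: congruenceMl. Qed.

Lemma congruence_preimMr (z x y : S) :
  C (h x) (h y) -> C (h (x * z)%g) (h (y * z)%g).
Proof. by rewrite !hM; apply: congruenceMr. Qed.

Definition congruence_preim : congruence S :=
  Congruence (fun x => congruence_refl C (h x))
    (fun x y => @congruence_sym _ C (h x) (h y))
    (fun x y z => @congruence_trans _ C (h x) (h y) (h z))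
    congruence_preimMl congruence_preimMr.

End CongruencePreim.

(** * The bicyclic semigroup *)

Lemma bicyclicM (s t : bicyclic) :
  (s * t)%g = (s.1 + t.1 - minn s.2 t.1, s.2 + t.2 - minn s.2 t.1).
Proof. by case: s t => [i j] [k l]. Qed.

(** The bicyclic semigroup is an inverse semigroup: inverses are unique. *)
Lemma bicyclic_inverse (s t : bicyclic) :
  (s * t * s = s)%g -> (t * s * t = t)%g -> t = (s.2, s.1).
Proof.
case: s t => [i j] [k l]; rewrite !bicyclicM /= => -[h1 h2] [h3 h4].
by congr pair; lia.
Qed.

(** Multiplying by (0, i) on the left and (j, 0) on the right moves (i, j) to the
identity and, if i is at most its first coordinate, the other element to some u
that is not the identity; the opposite case is symmetric.  A nonzero
coordinate of u means that u absorbs the idempotent (1, 1) on that side, so that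
(1, 1) is congruent to u, hence to the identity. *)
Lemma bicyclic_congruence (R : congruence bicyclic) (s t : bicyclic) :
  s <> t -> R s t -> forall n, R (0, 0) (n, n).
Proof.
move=> st Rst; have R01 : R (0, 0) (1, 1).
  wlog le_st : s t st Rst / s.1 <= t.1.
    move=> H; have [|/ltnW] := leqP s.1 t.1; first exact: H.
    apply: H; first by move=> /esym.
    exact: congruence_sym.
  case: s t st Rst le_st => [i j] [k l] st Rst /= ik.
  have [u [R0u u0]] : exists u : bicyclic, R (0, 0) u /\ (0 < u.1 \/ 0 < u.2).
    pose p : bicyclic := (0, i); pose q : bicyclic := (j, 0).
    exists (p * (k, l) * q)%g; split.
      suff <- : (p * (i, j) * q)%g = (0, 0) by exact/congruenceMr/congruenceMl.
      by rewrite !bicyclicM /=; congr pair; lia.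
    rewrite !bicyclicM /=; have [|ki] := ltnP i k; first by left; lia.
    have {}ki : k = i by lia.
    have lj : l <> j by move=> lj; apply: st; rewrite ki lj.
    by lia.
  apply: (congruence_trans R0u); apply: congruence_sym.
  pose d : bicyclic := (1, 1).
  case: u0 => u0.
    suff <- : (d * u)%g = u by exact: (congruenceMl d R0u).
    by rewrite bicyclicM [RHS]surjective_pairing /=; congr pair; lia.
  suff <- : (u * d)%g = u by exact: (congruenceMr d R0u).
  by rewrite bicyclicM [RHS]surjective_pairing /=; congr pair; lia.
elim=> [|n IHn]; first exact: congruence_refl.
apply: (congruence_trans R01).
pose p : bicyclic := (1, 0); pose q : bicyclic := (0, 1).
suff step m : (m.+1, m.+1) = (p * (m, m) * q)%g.
  by rewrite (step 0) (step n); apply/congruenceMr/congruenceMl.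
by rewrite !bicyclicM /=; congr pair; lia.
Qed.

(** * Coordinates on the semigroup of triples *)

(** The left end of a half-line; 0 for a set that is not a half-line. *)
Definition start (A : set nat) : nat :=
  xget 0 [set a | A = [set k | a <= k]].

Lemma startE (A : set nat) : nonempty A -> inductive_set A ->
  A = [set k | start A <= k].
Proof.
move=> [a Aa] Aind; rewrite /start; case: xgetP => [m _ //|H].
have exA : exists k, `[< A k >] by exists a; apply/asboolP.
case: (ex_minnP exA) => m /asboolP Am m_min.
case: (H m) => /=; apply/seteqP; split=> k /=.
  by move=> Ak; apply: m_min; apply/asboolP.
move=> /subnKC <-; elim: (k - m) => [|n IHn]; first by rewrite addn0.
by rewrite addnS; apply: Aind.
Qed.

Lemma start_up (a : nat) : start [set k | a <= k] = a.
Proof.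
have up0 : nonempty [set k | a <= k] by exists a => /=.
have up_ind : inductive_set [set k | a <= k] by move=> i /=; apply: leqW.
have := startE up0 up_ind; set b := start _ => /seteqP [ab ba].
by apply/eqP; rewrite eqn_leq; apply/andP; split; [apply: ab|apply: ba] => /=.
Qed.

Section Coordinates.
Context (F : omega_closed_family).

Definition pos (x : BwF F) : bicyclic := (val x).1.

(** If an element is viewed as the shift by j - i whose domain is the half-line
starting at i + a and whose range is the one starting at j + a, then [apex]
lists these two ends. *)
Definition apex (x : BwF F) : bicyclic :=
  ((val x).1.1 + start (val x).2, (val x).1.2 + start (val x).2).

Definition translate (x : BwF F) (s : bicyclic) : BwF F :=
  SigSub (mem_set (set_valP x : triples F (s, (val x).2))).

Lemma pos_translate x s : pos (translate x s) = s.
Proof. by []. Qed.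

Lemma apex_translate x s :
  apex (translate x s) = (s.1 + start (val x).2, s.2 + start (val x).2).
Proof. by []. Qed.

Lemma val_BwFM (x y : BwF F) : val (x * y)%g = triple_mul (val x) (val y).
Proof. by []. Qed.

Lemma posM : {morph pos : x y / (x * y)%g}.
Proof.
move=> x y; rewrite /pos val_BwFM bicyclicM.
by case: (val x) (val y) => [[i1 j1] F1] [[i2 j2] F2]; rewrite triple_mulE.
Qed.

Context (F_nonempty : forall A : set nat, family_set F A -> nonempty A).
Context (F_inductive : forall A : set nat, family_set F A -> inductive_set A).

Lemma family_startE (x : BwF F) : (val x).2 = [set k | start (val x).2 <= k].
Proof.
have Fx : family_set F (val x).2 := set_valP x.
by apply: startE; [apply: F_nonempty|apply: F_inductive].
Qed.

(** The composite of two shifts is defined where the range of the first one meets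
the domain of the second: above the maximum of j1 + a1 and i2 + a2, in accordance
with the bicyclic rule for the pairs (i1 + a1, j1 + a1) and (i2 + a2, j2 + a2). *)
Lemma apexM : {morph apex : x y / (x * y)%g}.
Proof.
move=> x y; rewrite /apex val_BwFM bicyclicM.
have := family_startE x; have := family_startE y.
case: (val x) (val y) => [[i1 j1] F1] [[i2 j2] F2]; rewrite triple_mulE /=.
move: (start F1) (start F2) => a1 a2 -> ->.
rewrite (_ : mkset _ = [set k | maxn (a1 - (i2 - j1)) (a2 - (j1 - i2)) <= k]).
  by rewrite start_up; congr pair; lia.
by apply/seteqP; split=> k /=; lia.
Qed.

Lemma pos_apex_inj (x y : BwF F) : pos x = pos y -> apex x = apex y -> x = y.
Proof.
move=> pxy axy; apply: val_inj; rewrite /=.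
rewrite [LHS]surjective_pairing [RHS]surjective_pairing family_startE.
rewrite [(val y).2]family_startE.
by move: pxy axy; rewrite /pos /apex => -> [] /addnI -> _.
Qed.

Lemma translateM x : {morph translate x : s t / (s * t)%g}.
Proof.
move=> [i j] [k l]; apply: pos_apex_inj.
  by rewrite posM !pos_translate.
by rewrite apexM !apex_translate !bicyclicM /=; congr pair; lia.
Qed.

(** * Copies of the bicyclic semigroup *)

Definition layer_set (x : BwF F) : set (BwF F) :=
  [set y | exists s, y = translate x s].

Lemma layerM x y z : layer_set x y -> layer_set x z -> layer_set x (y * z)%g.
Proof. by move=> [s ->] [t ->]; exists (s * t)%g; rewrite translateM. Qed.

Definition layer x : subsemigroup (BwF F) := Subsemigroup (@layerM x).

Lemma layer_isomorphic x : isomorphic (subsemigroup_type (layer x)) bicyclic.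
Proof.
pose f (y : subsemigroup_type (layer x)) : bicyclic := pos (val y).
have fM : {morph f : y z / (y * z)%g} by move=> y z; rewrite /f -posM.
exists (HB.pack_for {multiplicative (subsemigroup_type (layer x)) -> bicyclic}
  f (isMultiplicative.Build _ _ f fM)).
have Lx s : layer_set x (translate x s) by exists s.
exists (fun s => SigSub (mem_set (Lx s))) => // y.
apply: val_inj => /=.
by have [s ys] := set_valP y; rewrite /f ys.
Qed.

(** Transports the inverse of an isomorphism into an injective morphism with values
in the ambient semigroup, which avoids the subtype in what follows. *)
Lemma bicyclic_copy (S : subsemigroup (BwF F)) :
  isomorphic (subsemigroup_type S) bicyclic ->
  exists h : bicyclic -> BwF F, [/\ {morph h : s t / (s * t)%g}, injective h,
    forall s, subsemigroup_set S (h s) &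
    forall x, subsemigroup_set S x -> exists s, x = h s].
Proof.
move=> [f [g fK gK]].
have gM := can2_gmulfM fK gK.
exists (fun s => val (g s)); split.
- by move=> s t; rewrite gM.
- by move=> s t /val_inj /(can_inj gK).
- by move=> s; apply: set_valP.
- move=> x Sx; exists (f (SigSub (mem_set Sx))).
  by rewrite fK.
Qed.

(** The images p and q of the two generators (0, 1) and (1, 0) are mutually
inverse, in both coordinates; so q has the same set as p, with the position
transposed, and p q and q p are the idempotents of the layer of p at the two
coordinates of the position of p.  The strict inequality holds because q p lies
strictly below p q. *)
Lemma copy_translate (h : bicyclic -> BwF F) :
  {morph h : s t / (s * t)%g} -> injective h ->
  exists x i j, [/\ i < j, h (0, 0) = translate x (i, i) &
                          h (1, 1) = translate x (j, j)].
Proof.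
move=> hM h_inj.
set p := h (0, 1); set q := h (1, 0).
have pq : h (0, 0) = (p * q)%g by rewrite -hM.
have qp : h (1, 1) = (q * p)%g by rewrite -hM.
have pqp : (p * q * p = p)%g by rewrite -!hM.
have qpq : (q * p * q = q)%g by rewrite -!hM.
have pqqp : (p * q * (q * p) = q * p)%g by rewrite -!hM.
have pos_q : pos q = ((pos p).2, (pos p).1).
  by apply: bicyclic_inverse; rewrite -!posM ?pqp ?qpq.
have apex_q : apex q = ((apex p).2, (apex p).1).
  by apply: bicyclic_inverse; rewrite -!apexM ?pqp ?qpq.
have e_pq : h (0, 0) = translate p ((pos p).1, (pos p).1).
  rewrite pq; apply: pos_apex_inj.
    by rewrite posM pos_q bicyclicM /=; congr pair; lia.
  by rewrite apexM apex_q apex_translate bicyclicM /apex /pos /=; congr pair; lia.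
have e_qp : h (1, 1) = translate p ((pos p).2, (pos p).2).
  rewrite qp; apply: pos_apex_inj.
    by rewrite posM pos_q bicyclicM /=; congr pair; lia.
  by rewrite apexM apex_q apex_translate bicyclicM /apex /pos /=; congr pair; lia.
exists p, (pos p).1, (pos p).2; split=> //.
have ne : (pos p).1 <> (pos p).2.
  by move=> E; have /h_inj : h (0, 0) = h (1, 1) by rewrite e_pq e_qp E.
move: pqqp; rewrite -qp -pq e_pq e_qp => /(congr1 pos).
rewrite posM !pos_translate bicyclicM /= => -[].
by lia.
Qed.

(** * Congruences that are not injective on some copy *)

Lemma idempotent_coords (e : BwF F) : (e * e)%g = e ->
  exists i, pos e = (i, i) /\
            apex e = (i + start (val e).2, i + start (val e).2).
Proof.
move=> /(congr1 pos); rewrite posM bicyclicM /apex /pos.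
case: (val e) => [[i j] A] /= [ij ji]; exists i.
by have -> : j = i by lia.
Qed.

(** An idempotent below the idempotent of [x] at (0, 0) is also above the idempotent
of [x] at (N, N) for large N, and is thus squeezed between two congruent ones.
Any idempotent e is conjugate to an idempotent f of its own layer that is far
enough along to be below; replacing f by a congruent idempotent of the layer of
[x] and conjugating back gives an idempotent w congruent to e which is below as
well, since its starting point is at least that of [x]. *)
Lemma idempotents_congruent (C : congruence (BwF F)) (x : BwF F) :
  (forall n, C (translate x (0, 0)) (translate x (n, n))) ->
  forall e, (e * e)%g = e -> C e (translate x (0, 0)).
Proof.
move=> Cx.
set c := start (val x).2.
have below e : (e * e)%g = e -> c <= (apex e).1 -> C e (translate x (0, 0)).
  move=> /idempotent_coords [i [pe ae]] ce.
  (* N >= i and N + c >= apex e, so the idempotent at (N, N) is below e. *)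
  set N := i + start (val e).2 in ae; rewrite ae /= in ce.
  have e0 : (e * translate x (0, 0) = e)%g.
    apply: pos_apex_inj.
      by rewrite posM pe pos_translate bicyclicM /=; congr pair; lia.
    by rewrite apexM ae apex_translate bicyclicM /= -/c; congr pair; lia.
  have eN : (e * translate x (N, N) = translate x (N, N))%g.
    apply: pos_apex_inj.
      by rewrite posM pe !pos_translate bicyclicM /=; congr pair; lia.
    by rewrite apexM ae !apex_translate bicyclicM /= -/c; congr pair; lia.
  have := congruenceMl e (Cx N); rewrite e0 eN => CeN.
  exact: congruence_trans CeN (congruence_sym (Cx N)).
move=> e /idempotent_coords [i]; set a := start (val e).2 => -[pe ae].
pose u := translate e (i, i + c).
pose v := translate e (i + c, i).
pose f := translate e (i + c, i + c).
have ufv : (u * f * v = e)%g.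
  rewrite /u /f /v -!translateM; apply: pos_apex_inj.
    by rewrite pe !pos_translate !bicyclicM /=; congr pair; lia.
  by rewrite ae !apex_translate !bicyclicM /= -/a; congr pair; lia.
set w := (u * translate x (i + c, i + c) * v)%g.
have pw : pos w = (i, i).
  by rewrite /w !posM !pos_translate !bicyclicM /=; congr pair; lia.
have aw : apex w = (i + maxn a c, i + maxn a c).
  rewrite /w !apexM !apex_translate !bicyclicM /= -/a -/c.
  by congr pair; lia.
have Cew : C e w.
  rewrite -{1}ufv; apply: congruenceMr; apply: congruenceMl.
  apply: congruence_trans (Cx _).
  apply: below; last by rewrite apex_translate /=; lia.
  by rewrite -translateM bicyclicM /=; congr translate; congr pair; lia.
apply: (congruence_trans Cew); apply: below; last by rewrite aw /=; lia.
apply: pos_apex_inj; first by rewrite posM pw bicyclicM /=; congr pair; lia.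
by rewrite apexM aw bicyclicM /=; congr pair; lia.
Qed.

(** The criterion for bicyclic congruences is used twice: in the copy, to identify
h (0, 0) with h (1, 1), and in the layer that contains both. *)
Lemma identified_group_congruence (C : congruence (BwF F))
    (h : bicyclic -> BwF F) (s t : bicyclic) :
  {morph h : s t / (s * t)%g} -> injective h ->
  s <> t -> C (h s) (h t) -> group_congruence C.
Proof.
move=> hM h_inj st Cst.
have C01 := @bicyclic_congruence (congruence_preim hM C) s t st Cst 1.
have [x [i [j [ij h0 h1]]]] := copy_translate hM h_inj.
have Cij : C (translate x (i, i)) (translate x (j, j)) by rewrite -h0 -h1.
have ijP : (i, i) <> (j, j) :> bicyclic by move=> [E]; lia.
have Cx := @bicyclic_congruence (congruence_preim (translateM x) C) _ _ ijP Cij.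
have Ce := idempotents_congruent Cx.
apply: (@idempotent_group_congruence _ C
  (fun y => translate y ((pos y).2, (pos y).1)) x).
  move=> y; apply: pos_apex_inj.
    rewrite !posM pos_translate !bicyclicM /= [RHS]surjective_pairing.
    by congr pair; lia.
  rewrite !apexM apex_translate !bicyclicM /apex /pos /=.
  by congr pair; lia.
move=> f g ff gg.
exact: congruence_trans (Ce _ ff) (congruence_sym (Ce _ gg)).
Qed.

End Coordinates.

Theorem mainTheorem1 (F : omega_closed_family)
    (F_nonempty : forall A : set nat, family_set F A -> nonempty A)
    (F_inductive : forall A : set nat, family_set F A -> inductive_set A)
    (C : congruence (BwF F)) :
  let identifies (S : subsemigroup (BwF F)) : Prop :=
    exists x y : BwF F, [/\ subsemigroup_set S x, subsemigroup_set S y, x <> y & C x y] in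
  [<-> group_congruence C;
       exists S : subsemigroup (BwF F),
         isomorphic (subsemigroup_type S) bicyclic /\ identifies S;
       forall T : subsemigroup (BwF F),
         isomorphic (subsemigroup_type T) bicyclic -> identifies T].
Proof.
move=> identifies.
have [A FA] := family_nonempty F.
pose x0 : BwF F := SigSub (mem_set (FA : triples F (0, 0, A))).
pose L := layer F_nonempty F_inductive x0.
have L_iso := layer_isomorphic F_nonempty F_inductive x0 :
  isomorphic (subsemigroup_type L) bicyclic.
have group_identifies T : group_congruence C ->
    isomorphic (subsemigroup_type T) bicyclic -> identifies T.
  move=> GC /bicyclic_copy [h [hM h_inj hT _]].
  exists (h (0, 0)), (h (1, 1)); split=> //; first by move=> /h_inj.
  by apply: group_congruence_idempotent => //; rewrite -hM.
have identifies_group S : isomorphic (subsemigroup_type S) bicyclic ->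
    identifies S -> group_congruence C.
  move=> /bicyclic_copy [h [hM h_inj _ hS]].
  move=> [_ [_ [/hS[s ->] /hS[t ->] st Cst]]].
  apply: (identified_group_congruence F_nonempty F_inductive hM h_inj _ Cst).
  by move=> E; apply: st; rewrite E.
tfae.
- by move=> GC; exists L; split=> //; apply: group_identifies.
- move=> [S [S_iso S_id]] T T_iso.
  by apply: group_identifies => //; apply: identifies_group S_id.
- by move=> H; apply: identifies_group L_iso (H _ L_iso).
Qed.
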